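(* Let $\mathcal{H}$ be a complex Hilbert space of finite dimension $d$, let $0\le\varepsilon\le1$, and let $\mathcal{N}:\mathcal{L}(\mathcal{H})\to\mathcal{L}(\mathcal{H})$ be the depolarizing noise $$\mathcal{N}(\rho)=(1-\varepsilon)\rho+\varepsilon\,\frac{\operatorname{Tr}\rho}{d}\,1 .$$ (i) If $\varepsilon\le d/(d+1)$, then the ``do nothing'' protocol, i.e. the one-outcome ex-ante-ex-post control protocol $\{(\mathcal{I}_1,\mathcal{C}_1)\}=\{(\mathrm{id},\mathrm{id})\}$, is optimal for $\mathcal{N}$, and the optimal average fidelity is $1-\varepsilon(d-1)/d$. (ii) If $\varepsilon\ge d/(d+1)$, then for every orthonormal basis $\{|\phi_\omega\rangle\}_{\omega=1,\dots,d}$ of $\mathcal{H}$ the ``discriminate and reprepare'' protocol $\{(\mathcal{I}_\omega,\mathcal{C}_\omega)\}_{\omega=1,\dots,d}$ given by $$\mathcal{I}_\omega(\rho)=|\phi_\omega\rangle\langle\phi_\omega|\,\rho\,|\phi_\omega\rangle\langle\phi_\omega|,\qquad \mathcal{C}_\omega(\rho)=|\phi_\omega\rangle\langle\phi_\omega|\operatorname{Tr}\rho$$ is optimal for $\mathcal{N}$, and the optimal average fidelity is $2/(d+1)$.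
   Context: $\mathcal{L}(\mathcal{H})$ is the space of linear operators on the finite-dimensional complex Hilbert space $\mathcal{H}$, $1$ is the identity operator on $\mathcal{H}$, and $\mathrm{id}$ is the identity map on $\mathcal{L}(\mathcal{H})$. TPCP means trace-preserving and completely positive. A noise process is a TPCP map $\mathcal{N}:\mathcal{L}(\mathcal{H})\to\mathcal{L}(\mathcal{H})$. An ex-ante-ex-post control protocol is a family $\{(\mathcal{I}_\omega,\mathcal{C}_\omega)\}_{\omega\in\Omega}$ indexed by a finite set $\Omega$ (arbitrary, depending on the protocol), where each $\mathcal{I}_\omega:\mathcal{L}(\mathcal{H})\to\mathcal{L}(\mathcal{H})$ is completely positive, $\sum_{\omega\in\Omega}\mathcal{I}_\omega$ is trace-preserving (i.e. $\{\mathcal{I}_\omega\}$ is a CP instrument), and each $\mathcal{C}_\omega:\mathcal{L}(\mathcal{H})\to\mathcal{L}(\mathcal{H})$ is TPCP. The average operation of the protocol for noise $\mathcal{N}$ is $\mathcal{E}=\sum_{\omega\in\Omega}\mathcal{C}_\omega\circ\mathcal{N}\circ\mathcal{I}_\omega$, and its average fidelity is $$\bar F=\int_{\|\psi\|=1}\langle\psi|\,\mathcal{E}(|\psi\rangle\langle\psi|)\,|\psi\rangle\,d\psi ,$$ where $d\psi$ is the normalized uniform (unitarily invariant) probability measure on the unit sphere of $\mathcal{H}$. A protocol is optimal for $\mathcal{N}$ (optimally suppresses $\mathcal{N}$) if its average fidelity for $\mathcal{N}$ is greater than or equal to that of every ex-ante-ex-post control protocol; the optimal average fidelity is this maximal value.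 *)

(* Defs.v *)
From HB Require Import structures.
From mathcomp Require Import all_boot all_order all_algebra spectral.
From mathcomp Require Import all_classical all_reals all_analysis.
From mathcomp Require Import complex ring.

Set Implicit Arguments.
Unset Strict Implicit.
Unset Printing Implicit Defensive.

Import Order.TTheory GRing.Theory Num.Theory.
Import numFieldNormedType.Exports.

Local Open Scope classical_set_scope.
Local Open Scope complex_scope.
Local Open Scope sesquilinear_scope.
Local Open Scope ring_scope.

(* A Hilbert space of dimension d is C^d with kets as column vectors and the
   inner product <u|v> = (u^t* *m v) 0 0 (conjugate-linear on the left);
   L(H) is 'M[R[i]]_d. *)
Notation superop R d := {linear 'M[R[i]]_d -> 'M[R[i]]_d}.

Section ControlProtocols.
Variables (R : realType) (d : nat).
Local Notation C := R[i].
Local Notation vec := 'cV[C]_d.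
Local Notation op := 'M[C]_d.

Definition braket (u v : vec) : C := (u^t* *m v) 0 0.

Definition ketbra (u : vec) : op := u *m u^t*.

(* The order on C entails that <v|A|v> is real. *)
Definition psd n (A : 'M[C]_n) := forall v : 'cV[C]_n, 0 <= (v^t* *m A *m v) 0 0.

(* id_k (x) Phi on L(C^k (x) C^d), operators being k x k arrays of d x d blocks. *)
Definition ampliation k (Phi : superop R d) (A : 'M[C]_(\sum_(i < k) d)) :
    'M[C]_(\sum_(i < k) d) :=
  \mxblock_(i < k, j < k)
    Phi (submxblock (p_ := fun=> d) (q_ := fun=> d) A i j).

Definition completely_positive (Phi : superop R d) :=
  forall k A, psd A -> psd (@ampliation k Phi A).

Definition trace_preserving (Phi : op -> op) := forall A, \tr (Phi A) = \tr A.

Definition tpcp (Phi : superop R d) :=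
  completely_positive Phi /\ trace_preserving Phi.

Definition control_protocol (Omega : finType) (I K : Omega -> superop R d) :=
  [/\ forall w, completely_positive (I w),
      trace_preserving (fun A => \sum_w I w A)
    & forall w, tpcp (K w)].

Definition average_operation (N : superop R d) (Omega : finType)
    (I K : Omega -> superop R d) (A : op) : op :=
  \sum_w K w (N (I w A)).

(* C^d with its Borel sigma-algebra; C^o is C with its norm topology. *)
Definition borel_vec := g_sigma_algebraType (@open 'cV[C^o]_d).

(* The norm is the Hilbert one; `|_| on matrices would be the sup norm. *)
Definition unit_sphere : set borel_vec := [set psi : vec | braket psi psi = 1].

(* These conditions characterize the normalized uniform measure on the sphere,
   seen as a Borel measure on C^d. *)
Definition uniform_on_sphere (mu : probability borel_vec R) :=
  mu unit_sphere = 1%E /\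
  forall (U : op) (A : set borel_vec), U \is unitarymx -> measurable A ->
    mu ((fun psi : vec => U *m psi) @^-1` A) = mu A.

(* The integrand takes real values in C when N and the protocol are positive;
   Re only turns it into an element of R. *)
Definition average_fidelity (mu : probability borel_vec R) (N : superop R d)
    (Omega : finType) (I K : Omega -> superop R d) : R :=
  \int[mu]_(psi in unit_sphere)
    complex.Re (braket psi (average_operation N I K (ketbra psi) *m psi)).

Definition optimal (mu : probability borel_vec R) (N : superop R d)
    (Omega : finType) (I K : Omega -> superop R d) :=
  control_protocol I K /\
  forall (Omega' : finType) (I' K' : Omega' -> superop R d),
    control_protocol I' K' ->
    average_fidelity mu N I' K' <= average_fidelity mu N I K.

Definition optimal_average_fidelity (mu : probability borel_vec R)
    (N : superop R d) (F : R) :=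
  exists (Omega : finType) (I K : Omega -> superop R d),
    optimal mu N I K /\ average_fidelity mu N I K = F.

Definition depolarizing (eps : R) (rho : op) : op :=
  (1 - eps)%:C *: rho + (eps%:C * (\tr rho / d%:R)) *: 1%:M.

Lemma depolarizing_linear eps : linear (depolarizing eps).
Proof.
move=> a A B; rewrite /depolarizing mxtraceD mxtraceZ.
by rewrite !scalerDr !scalerA addrACA -scalerDl;
  congr (_ *: _ + _ + _ *: _); ring.
Qed.
HB.instance Definition _ eps :=
  GRing.isLinear.Build C op op _ (depolarizing eps) (depolarizing_linear eps).

Definition project (phi : vec) (rho : op) : op :=
  ketbra phi *m rho *m ketbra phi.

Lemma project_linear phi : linear (project phi).
Proof.
by move=> a A B; rewrite /project mulmxDr mulmxDl -scalemxAr -scalemxAl.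
Qed.
HB.instance Definition _ phi :=
  GRing.isLinear.Build C op op _ (project phi) (project_linear phi).

Definition reprepare (phi : vec) (rho : op) : op := \tr rho *: ketbra phi.

Lemma reprepare_linear phi : linear (reprepare phi).
Proof. by move=> a A B; rewrite /reprepare mxtraceD mxtraceZ scalerDl scalerA. Qed.
HB.instance Definition _ phi :=
  GRing.isLinear.Build C op op _ (reprepare phi) (reprepare_linear phi).

(* d orthonormal vectors in dimension d span the space. *)
Definition orthonormal_basis (phi : 'I_d -> vec) :=
  forall i j, braket (phi i) (phi j) = (i == j)%:R.

End ControlProtocols.

(* Main.v *)
(** The second moments of the uniform measure on the sphere turn the average
    fidelity of E into (Tr E(1) + S(E)) / (d (d + 1)), where
    S(E) = sum_kl <k|E(|k><l|)|l>. For Kraus operators A of an I_w and K of the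
    corresponding C_w, put
      x = |Tr AK|^2,  y = |AK|^2,  n = |A|^2 |K|^2,  z = |KA|^2
    (Frobenius norms). After summation over all Kraus operators n gives d^2,
    z gives d, and S(E) is the sum of (1 - eps) x + (eps / d) y. The bounds
    x <= n and y <= n are Cauchy-Schwarz; the trade-off between leaving the
    state alone (large x) and measuring it (large y) is x + y <= n + z. Writing
    (1 - eps) x + (eps / d) y as a nonnegative combination of x + y with x when
    eps <= d / (d + 1), and of x + y with y otherwise, yields the two optima. *)

Require Import Defs.
From mathcomp Require Import all_boot all_order all_algebra spectral.
From mathcomp Require Import all_classical all_reals all_analysis measurable_realfun complex.
From mathcomp Require Import ring lra.

Set Implicit Arguments.
Unset Strict Implicit.
Unset Printing Implicit Defensive.

Import Order.TTheory GRing.Theory Num.Theory.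
Import numFieldNormedType.Exports.

Local Open Scope classical_set_scope.
Local Open Scope complex_scope.
Local Open Scope sesquilinear_scope.
Local Open Scope ring_scope.

(** * Integration over the unit sphere *)

Lemma conjcE (R : realType) (x : R[i]) : Num.conj x = conjc x.
Proof. by []. Qed.

Lemma braketE (R : realType) (d : nat) (u v : 'cV[R[i]]_d) :
  braket u v = \sum_i (u i 0)^*%C * v i 0.
Proof. by rewrite /braket mxE; apply: eq_bigr => i _; rewrite !mxE conjcE. Qed.

Lemma unitarymxPC (C : numClosedFieldType) n (U : 'M[C]_n) : U \is unitarymx ->
  U^t* *m U = 1%:M.
Proof. by rewrite -trmxC_unitary => /unitarymxP; rewrite trmxCK. Qed.

Lemma mulCi_conj (R : realType) : 'i%C * ('i%C)^*%C = 1 :> R[i].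
Proof. by apply/eqP; rewrite eq_complex/=; apply/andP; split; apply/eqP; ring. Qed.

Lemma conjc_lin (R : realType) (x y : R) (a b : R[i]) :
  (x%:C * a + y%:C * b)^*%C = x%:C * a^*%C + y%:C * b^*%C.
Proof.
by rewrite rmorphD !rmorphM; congr (_ * _ + _ * _); exact: conjc_real.
Qed.

(** * Complex functions that are measurable, and bounded on the sphere *)

Section SphereIntegral.
Variables (R : realType) (d : nat).
Local Notation C := R[i].
Local Notation V := (borel_vec R d).
Local Notation vec := 'cV[C]_d.
Local Notation ReC := (@complex.Re R).
Local Notation ImC := (@complex.Im R).

(** An integrability criterion stable under sums, products and conjugation, hence valid for all
    polynomials in the coordinates and their conjugates. The bound is asked for on the sphere only,
    since such polynomials are unbounded on the whole space. *)
Definition measurable_bounded (f : V -> C) :=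
  [/\ measurable_fun setT (ReC \o f), measurable_fun setT (ImC \o f) &
      exists M : R, forall psi, unit_sphere psi -> `|f psi| <= M%:C].

Lemma eq_measurable_bounded (f g : V -> C) :
  f =1 g -> measurable_bounded f -> measurable_bounded g.
Proof. by move=> /funext ->. Qed.

Lemma normRe_le (x : C) : (`|ReC x|)%:C <= `|x|.
Proof.
by rewrite normc_def lecR -sqrtr_sqr ler_wsqrtr// lerDl sqr_ge0.
Qed.

Lemma normIm_le (x : C) : (`|ImC x|)%:C <= `|x|.
Proof.
by rewrite normc_def lecR -sqrtr_sqr ler_wsqrtr// lerDr sqr_ge0.
Qed.

Lemma measurable_bounded_cst (c : C) : measurable_bounded (fun=> c).
Proof.
split; [exact: measurable_cst | exact: measurable_cst |].
by exists (complex.Re `|c|) => psi _; rewrite RRe_real// normr_real.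
Qed.

Lemma measurable_boundedD f g : measurable_bounded f -> measurable_bounded g ->
  measurable_bounded (fun x => f x + g x).
Proof.
move=> [fr fi [M fM]] [gr gi [N gN]]; split.
- apply: (eq_measurable_fun (fun x => (ReC \o f) x + (ReC \o g) x)).
    by move=> x _ /=; case: (f x) => a b; case: (g x).
  exact: measurable_funD.
- apply: (eq_measurable_fun (fun x => (ImC \o f) x + (ImC \o g) x)).
    by move=> x _ /=; case: (f x) => a b; case: (g x).
  exact: measurable_funD.
- exists (M + N) => psi S; rewrite rmorphD/=.
  by apply: le_trans (ler_normD _ _) _; apply: lerD; [exact: fM | exact: gN].
Qed.

Lemma measurable_boundedM f g : measurable_bounded f -> measurable_bounded g ->
  measurable_bounded (fun x => f x * g x).
Proof.
move=> [fr fi [M fM]] [gr gi [N gN]]; split.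
- apply: (eq_measurable_fun (fun x =>
    (ReC \o f) x * (ReC \o g) x - (ImC \o f) x * (ImC \o g) x)).
    by move=> x _ /=; case: (f x) => a b; case: (g x).
  by apply: measurable_funB; apply: measurable_funM.
- apply: (eq_measurable_fun (fun x =>
    (ReC \o f) x * (ImC \o g) x + (ImC \o f) x * (ReC \o g) x)).
    by move=> x _ /=; case: (f x) => a b; case: (g x).
  by apply: measurable_funD; apply: measurable_funM.
- exists (M * N) => psi S; rewrite rmorphM/= normrM.
  by apply: ler_pM => //; [exact: fM | exact: gN].
Qed.

Lemma measurable_bounded_conj f : measurable_bounded f ->
  measurable_bounded (fun x => (f x)^*%C).
Proof.
move=> [fr fi [M fM]]; split.
- by apply: eq_measurable_fun fr => x _ /=; case: (f x).
- apply: (eq_measurable_fun (fun x => - (ImC \o f) x)).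
    by move=> x _ /=; case: (f x).
  exact: measurableT_comp.
- by exists M => psi S; rewrite -conjcE norm_conjC; exact: fM.
Qed.

Lemma measurable_bounded_sum (I : Type) (r : seq I) (f : I -> V -> C) :
  (forall i, measurable_bounded (f i)) ->
  measurable_bounded (fun x => \sum_(i <- r) f i x).
Proof.
move=> mf; elim: r => [|i r IH].
  apply: eq_measurable_bounded (measurable_bounded_cst 0) => x.
  by rewrite big_nil.
apply: eq_measurable_bounded (measurable_boundedD (mf i) IH) => x.
by rewrite big_cons.
Qed.

Lemma open_measurable_vec (A : set V) :
  open (A : set 'cV[C^o]_d) -> measurable A.
Proof. by move=> oA; apply: sub_sigma_algebra. Qed.

Lemma continuous_Re : continuous (ReC : C^o -> R).
Proof.
move=> x; have nbhsF : Filter (nbhs (x : C^o)) by exact: nbhs_filter.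
apply/(@cvgrPdist_lt _ R^o _ _ nbhsF) => e e0.
have e0' : 0 < e%:C :> C by rewrite ltcR.
have : nbhs (x : C^o) (ball (x : C^o) e%:C) by exact: nbhsx_ballx.
apply: (@filterS _ (nbhs (x : C^o))) => y; rewrite -ball_normE /= => xy.
rewrite -ltcR; apply: le_lt_trans xy.
by have := normRe_le (x - y); case: (x) => a b; case: (y).
Qed.

Lemma continuous_Im : continuous (ImC : C^o -> R).
Proof.
move=> x; have nbhsF : Filter (nbhs (x : C^o)) by exact: nbhs_filter.
apply/(@cvgrPdist_lt _ R^o _ _ nbhsF) => e e0.
have e0' : 0 < e%:C :> C by rewrite ltcR.
have : nbhs (x : C^o) (ball (x : C^o) e%:C) by exact: nbhsx_ballx.
apply: (@filterS _ (nbhs (x : C^o))) => y; rewrite -ball_normE /= => xy.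
rewrite -ltcR; apply: le_lt_trans xy.
by have := normIm_le (x - y); case: (x) => a b; case: (y).
Qed.

Lemma continuous_measurable_vec (f : 'cV[C^o]_d -> R) :
  continuous f -> measurable_fun [set: V] (f : V -> R).
Proof.
move=> /continuousP cf.
apply: (measurability _ (RGenOpens.measurableE R)).
move=> _ [_ [a [b ->] <-]]; rewrite setTI.
by apply: open_measurable_vec; apply: cf; exact: interval_open.
Qed.

(** Coordinates are continuous, hence Borel. On the sphere the squared modulus of a coordinate is
    one of several nonnegative terms with sum 1. *)
Lemma measurable_bounded_coord i : measurable_bounded (fun psi : V => psi i 0).
Proof.
have ccoord : continuous (fun psi : 'cV[C^o]_d => psi i 0 : C^o).
  exact: coord_continuous.
split.
- apply: (@continuous_measurable_vec (fun psi : 'cV[C^o]_d => ReC (psi i 0))).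
  move=> x; exact: (@continuous_comp 'cV[C^o]_d C^o R
    (fun psi => psi i 0) ReC x (ccoord x) (@continuous_Re (x i 0))).
- apply: (@continuous_measurable_vec (fun psi : 'cV[C^o]_d => ImC (psi i 0))).
  move=> x; exact: (@continuous_comp 'cV[C^o]_d C^o R
    (fun psi => psi i 0) ImC x (ccoord x) (@continuous_Im (x i 0))).
- exists 1 => psi; rewrite /unit_sphere/= braketE => S1.
  rewrite -(@ler_pXn2r _ 2)// ?nnegrE// expr1n -S1.
  rewrite (bigD1 i)//= -conjcE normCKC lerDl sumr_ge0// => j _.
  by rewrite -conjcE -normCKC exprn_ge0.
Qed.
End SphereIntegral.

(** * Integration against a unitarily invariant measure *)

Section UniformMoments.
Variables (R : realType) (d : nat) (mu : probability (borel_vec R d) R).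
Hypothesis hmu : uniform_on_sphere mu.
Local Notation C := R[i].
Local Notation V := (borel_vec R d).
Local Notation sphere := (@unit_sphere R d).
Local Notation ReC := (@complex.Re R).
Local Notation ImC := (@complex.Im R).

(** The sphere is where the measurable function [g], the squared norm, has real part 1 and imaginary
    part 0. *)
Lemma measurable_unit_sphere : measurable sphere.
Proof.
have [mr mi _] : measurable_bounded (fun psi : V => \sum_i psi i 0 * (psi i 0)^*%C).
  apply: measurable_bounded_sum => i; apply: measurable_boundedM.
    exact: measurable_bounded_coord.
  exact/measurable_bounded_conj/measurable_bounded_coord.
set g := (fun psi : V => _) in mr mi.
have -> : sphere = (ReC \o g) @^-1` [set 1] `&` (ImC \o g) @^-1` [set 0].
  apply/seteqP; split => psi /=; rewrite /unit_sphere /g/= braketE.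
    by under eq_bigr do rewrite mulrC; move=> ->.
  under [X in _ -> X = _]eq_bigr do rewrite mulrC.
  by case: (\sum_i _) => a b /= [-> ->].
apply: measurableI.
- by rewrite -[X in measurable X]setTI; apply: mr => //; exact: measurable_set1.
- by rewrite -[X in measurable X]setTI; apply: mi => //; exact: measurable_set1.
Qed.

Lemma bounded_integrable (D : set V) (f : V -> R) (M : R) :
  measurable D -> measurable_fun setT f ->
  (forall x, D x -> `|f x| <= M) -> mu.-integrable D (EFin \o f).
Proof.
move=> mD mf fM; apply: measurable_bounded_integrable => //.
- by apply: le_lt_trans (probability_le1 _ _) _ => //; rewrite ltry.
- exact: measurable_funTS.
- exists M; split; first exact: num_real.
  by move=> N MN x /= Dx; apply: le_trans (fM x Dx) (ltW MN).
Qed.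

Lemma Re_integrable f : measurable_bounded f ->
  mu.-integrable sphere (EFin \o (ReC \o f)).
Proof.
move=> [mr _ [M fM]]; apply: (@bounded_integrable _ _ M) => //.
  exact: measurable_unit_sphere.
by move=> x Sx; rewrite -lecR (le_trans (normRe_le _))// fM.
Qed.

Lemma Im_integrable f : measurable_bounded f ->
  mu.-integrable sphere (EFin \o (ImC \o f)).
Proof.
move=> [_ mi [M fM]]; apply: (@bounded_integrable _ _ M) => //.
  exact: measurable_unit_sphere.
by move=> x Sx; rewrite -lecR (le_trans (normIm_le _))// fM.
Qed.

(** Integrating real and imaginary parts separately gives a functional linear over [C]; its real
    part at the integrand of the fidelity is [average_fidelity]. *)
Definition cint (f : V -> C) : C :=
  (\int[mu]_(x in sphere) ReC (f x)) +i* (\int[mu]_(x in sphere) ImC (f x)).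

Lemma eq_cint (f g : V -> C) : {in sphere, f =1 g} -> cint f = cint g.
Proof.
by move=> fg; congr (_ +i* _); apply: eq_Rintegral => x xS; rewrite fg.
Qed.

Lemma cint_cst c : cint (fun=> c) = c.
Proof.
have S1 : fine (mu sphere) = 1 by case: hmu => ->.
by rewrite /cint !(Rintegral_cst mu measurable_unit_sphere) S1 !mulr1; case: c.
Qed.

Lemma cintD f g : measurable_bounded f -> measurable_bounded g ->
  cint (fun x => f x + g x) = cint f + cint g.
Proof.
move=> mf mg; have mS := measurable_unit_sphere.
rewrite /cint; congr (_ +i* _); rewrite -RintegralD//.
- by apply: eq_Rintegral => x _; case: (f x) => a b; case: (g x).
- exact: Re_integrable.
- exact: Re_integrable.
- by apply: eq_Rintegral => x _; case: (f x) => a b; case: (g x).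
- exact: Im_integrable.
- exact: Im_integrable.
Qed.

Lemma cintZ c f : measurable_bounded f -> cint (fun x => c * f x) = c * cint f.
Proof.
move=> mf; have mS := measurable_unit_sphere.
have iR := Re_integrable mf; have iI := Im_integrable mf.
have mult r h : mu.-integrable sphere (EFin \o h) ->
    mu.-integrable sphere (EFin \o (fun x => r * h x)).
  move=> ih; have := integrableZl mS r ih.
  by apply: eq_integrable => // x _; rewrite /= EFinM.
have iRI := mult _ _ iR; have iII := mult _ _ iI.
case: c => a b; rewrite /cint; congr (_ +i* _).
- under eq_Rintegral => x _.
    have -> : ReC ((a +i* b) * f x) = a * ReC (f x) - b * ImC (f x).
      by case: (f x).
    over.
  by rewrite RintegralB ?RintegralZl.
- under eq_Rintegral => x _.
    have -> : ImC ((a +i* b) * f x) = a * ImC (f x) + b * ReC (f x).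
      by case: (f x).
    over.
  by rewrite RintegralD ?RintegralZl.
Qed.

Lemma cint_sum (I : Type) (r : seq I) (f : I -> V -> C) :
  (forall i, measurable_bounded (f i)) ->
  cint (fun x => \sum_(i <- r) f i x) = \sum_(i <- r) cint (f i).
Proof.
move=> mf; elim: r => [|i r IH].
  rewrite big_nil -[RHS](cint_cst 0); apply: eq_cint => x _.
  by rewrite big_nil.
rewrite big_cons -IH -cintD//; last exact: measurable_bounded_sum.
by apply: eq_cint => x _; rewrite big_cons.
Qed.

(** The product is a finite sum of fixed columns of [U] scaled by the coordinates of [psi]. *)
Lemma continuous_mulmx (U : 'M[C^o]_d) :
  continuous (fun psi : 'cV[C^o]_d => U *m psi : 'cV[C^o]_d).
Proof.
have -> : (fun psi => U *m psi) =
    (fun psi : 'cV[C^o]_d => \sum_k psi k 0 *: (col k U : 'cV[C^o]_d)).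
  apply/funext => psi; apply/colP => i; rewrite mxE summxE.
  by apply: eq_bigr => k _; rewrite !mxE mulrC.
apply: continuous_big => [|k _ x]; first exact: add_continuous.
have nF : Filter (nbhs (x : 'cV[C^o]_d)) by exact: nbhs_filter.
by apply: (@cvgZr_tmp _ _ _ _ nF); exact: coord_continuous.
Qed.

Lemma unitarymx_sphere (U : 'M[C]_d) : U \is unitarymx ->
  (fun psi : V => U *m psi : V) @^-1` sphere = sphere.
Proof.
move=> uU; apply/seteqP; split => psi /=; rewrite /unit_sphere/= /braket.
  rewrite trmx_mul map_mxM -mulmxA [U^t* *m _]mulmxA.
  by rewrite (unitarymxPC uU) mul1mx.
rewrite trmx_mul map_mxM -mulmxA [U^t* *m _]mulmxA.
by rewrite (unitarymxPC uU) mul1mx.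
Qed.

Lemma measurable_mulmx (U : 'M[C]_d) :
  measurable_fun [set: V] (fun psi : V => U *m psi : V).
Proof.
have mE : @measurable _ V = <<s (@open 'cV[C^o]_d) >> by [].
apply: (measurability _ mE).
move=> _ [A oA <-]; rewrite setTI; apply: (@open_measurable_vec R d).
have /continuousP cU : continuous (fun psi : 'cV[C^o]_d => U *m psi : 'cV[C^o]_d).
  exact: continuous_mulmx.
exact: cU.
Qed.

(** Change of variables: a unitary preserves the sphere, and the image of [mu] under it is [mu]. *)
Lemma Rintegral_mulmx (U : 'M[C]_d) (h : V -> R) (M : R) :
  U \is unitarymx -> measurable_fun setT h ->
  (forall x, sphere x -> `|h x| <= M) ->
  \int[mu]_(x in sphere) h (U *m x) = \int[mu]_(x in sphere) h x.
Proof.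
move=> uU mh hM; have mS := measurable_unit_sphere.
have mU := measurable_mulmx U.
have SU := unitarymx_sphere uU.
(* Writing the domain as its own preimage under [U] turns the left side into an integral against the
   image measure. *)
congr fine; rewrite -[in LHS]SU.
rewrite -(@integral_pushforward _ _ _ _ _ _ mU mu sphere (EFin \o h)) //.
- apply: eq_measure_integral => A mA _ /=.
  by rewrite /pushforward/=; case: hmu => _; exact.
- exact/measurable_EFinP.
- rewrite SU; apply: (@bounded_integrable sphere (fun x => h (U *m x)) M) => //.
    exact: (measurableT_comp mh mU).
  by move=> x Sx; apply: hM; move: Sx; rewrite -{1}SU.
Qed.

Lemma cint_mulmx (U : 'M[C]_d) (f : V -> C) :
  U \is unitarymx -> measurable_bounded f -> cint (fun x => f (U *m x)) = cint f.
Proof.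
move=> uU [mr mi [M fM]]; congr (_ +i* _).
- apply: (@Rintegral_mulmx U (ReC \o f) M) => // x Sx.
  by rewrite -lecR (le_trans (normRe_le _))// fM.
- apply: (@Rintegral_mulmx U (ImC \o f) M) => // x Sx.
  by rewrite -lecR (le_trans (normIm_le _))// fM.
Qed.

(** * Fourth moments of the coordinates *)

Definition quartic (t : 'I_d * 'I_d * 'I_d * 'I_d) (psi : V) : C :=
  let: (i, j, k, l) := t in
  (psi i 0)^*%C * psi j 0 * psi k 0 * (psi l 0)^*%C.

(** The index order is that of the expansion of <psi|E(|psi><psi|)|psi>: this moment multiplies the
    entry (i, j) of E(|k><l|), so [i] and [l] are the conjugated indices. *)
Definition moment i j k l := cint (quartic (i, j, k, l)).

Lemma measurable_bounded_quartic t : measurable_bounded (quartic t).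
Proof.
have mc := @measurable_bounded_coord R d.
case: t => [[[i j] k] l]; do 3?apply: measurable_boundedM => //;
  by apply: measurable_bounded_conj.
Qed.

Lemma cint_quartics (I : Type) (r : seq I) (c : I -> C) t (f : V -> C) :
  (forall psi, f psi = \sum_(x <- r) c x * quartic (t x) psi) ->
  cint f = \sum_(x <- r) c x * cint (quartic (t x)).
Proof.
move=> fE; have mq := measurable_bounded_quartic.
rewrite (eq_cint (g := fun psi => \sum_(x <- r) c x * quartic (t x) psi)); last first.
  by move=> psi _; exact: fE.
rewrite cint_sum => [|x].
  by apply: eq_bigr => x _; rewrite cintZ.
by apply: measurable_boundedM => //; exact: measurable_bounded_cst.
Qed.

Lemma moment_swap i j k l : moment i j k l = moment i k j l.
Proof. by apply: eq_cint => psi _; rewrite /quartic; ring. Qed.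

(** Invariance under the diagonal unitary that multiplies coordinate [q] by the imaginary unit and
    fixes the others. *)
Lemma moment_phase q i j k l :
  let u p : C := if p == q then 'i%C else 1 in
  moment i j k l = (u i)^*%C * u j * u k * (u l)^*%C * moment i j k l.
Proof.
move=> u; pose U := diag_mx (\row_p u p).
have uU : U \is unitarymx.
  apply/unitarymxP; rewrite tr_diag_mx map_diag_mx mulmx_diag.
  rewrite -diag_const_mx; congr diag_mx; apply/rowP => p; rewrite !mxE /u.
  by case: eqP => _; [exact: mulCi_conj | rewrite rmorph1 mulr1].
have mq := measurable_bounded_quartic (i, j, k, l).
rewrite /moment -{1}(cint_mulmx uU mq) -cintZ//; apply: eq_cint => psi _.
by rewrite /quartic mul_diag_mx !mxE !rmorphM/=; ring.
Qed.

(* Multiplying a single coordinate by the phase i fixes the measure but scales the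
   moment by i, -i or -1, unless conjugated and plain indices match up. *)
Lemma moment_eq0 i j k l :
  ~~ ((i == j) && (k == l)) -> ~~ ((i == k) && (j == l)) -> moment i j k l = 0.
Proof.
have i1 : 'i%C != 1 :> C by rewrite eq_complex/= eq_sym oner_eq0.
have ci1 : ('i%C)^*%C != 1 :> C by rewrite eq_complex/= eq_sym oner_eq0.
have ii : ('i%C)^*%C * 'i%C = 1 :> C.
  by rewrite mulrC mulCi_conj.
have ci2 : ('i%C)^*%C * ('i%C)^*%C = -1 :> C.
  by rewrite -rmorphM -expr2 sqr_i rmorphN rmorph1.
have kill c m : c != 1 -> m = c * m -> m = 0 :> C.
  move=> c1 /eqP; rewrite -subr_eq0 -{1}[m]mul1r -mulrBl mulf_eq0.
  by rewrite subr_eq0 eq_sym (negbTE c1) => /eqP.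
have N11 : -1 != 1 :> C.
  by rewrite -subr_eq0 -opprD oppr_eq0 -[1 + 1]/(2%:R) pnatr_eq0.
(* The phase is put on an index that cannot be matched: on [k] if i = j, on [j] if i = k, and
   otherwise on [i], where a coincidence l = i turns the factor -i into -1. *)
have [<-/= kl _|ij _] := eqVneq i j.
  have := moment_phase k i i k l; rewrite /= eqxx [l == k]eq_sym (negbTE kl).
  by apply: kill; case: (i == k); rewrite ?ii conjc1 ?mul1r ?mulr1 ?ii// mul1r.
have [<-/= jl|ik _] := eqVneq i k.
  have := moment_phase j i j i l; rewrite /= eqxx (negbTE ij) [l == j]eq_sym.
  by rewrite (negbTE jl) => /kill; apply; rewrite conjc1 mul1r !mulr1.
have := moment_phase i i j k l; rewrite /= eqxx ![_ == i]eq_sym (negbTE ij) (negbTE ik).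
by apply: kill; case: (i == l); rewrite ?conjc1 !mulr1 ?ci2.
Qed.

Lemma moment_pairC i k : moment k k i i = moment i i k k.
Proof. by apply: eq_cint => psi _; rewrite /quartic; ring. Qed.

(** Invariance under [U] replaces coordinate [m] by a real combination of coordinates [i] and [k].
    Of the sixteen resulting monomials ten vanish by [moment_eq0]; the four surviving mixed ones
    have equal integrals. *)
Lemma moment_combine (U : 'M[C]_d) m i k (x y : R) : i != k -> U \is unitarymx ->
  (forall psi : 'cV[C]_d, (U *m psi) m 0 = x%:C * psi i 0 + y%:C * psi k 0) ->
  moment m m m m = x%:C ^+ 4 * moment i i i i + y%:C ^+ 4 * moment k k k k +
    4 * (x%:C ^+ 2 * y%:C ^+ 2) * moment i i k k.
Proof.
move=> ik uU Um; have ki : k != i by rewrite eq_sym.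
pose w p : C := if p == i then x%:C else y%:C.
pose two := [:: i; k].
(* All sixteen quadruples with entries in {i, k}; [c] gives their coefficients. *)
pose r := [seq (pqr, t) | pqr <- [seq (pq, r) | pq <- [seq (p, q) | p <- two, q <- two],
  r <- two], t <- two].
pose c (t : 'I_d * 'I_d * 'I_d * 'I_d) :=
  let: (p, q, r, s) := t in w p * w q * w r * w s.
have mq := measurable_bounded_quartic (m, m, m, m).
rewrite {1}/moment -(cint_mulmx uU mq).
rewrite (@cint_quartics _ r c id) => [|psi]; last first.
  rewrite /r/= !big_cons big_nil /c /w /quartic eqxx (negbTE ki) Um.
  by rewrite conjc_lin; ring.
rewrite /r /two/= !big_cons big_nil /c /w eqxx (negbTE ki).
rewrite -!/(moment _ _ _ _).
have Z p q u v := @moment_eq0 p q u v.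
rewrite (Z i i i k) ?(Z i i k i) ?(Z i k i i) ?(Z i k k i) ?(Z i k k k)
  ?(Z k i i i) ?(Z k i i k) ?(Z k i k k) ?(Z k k i k) ?(Z k k k i);
  rewrite ?eqxx ?(negbTE ik) ?(negbTE ki)//.
rewrite (moment_swap i k i k) (moment_swap k i k i) (moment_pairC i k).
ring.
Qed.

(** For distinct [i] and [k], coordinate [i] becomes c psi_i + s psi_k and coordinate [k] becomes c
    psi_k - s psi_i. Writing it as a correction of the identity reduces unitarity to an algebra with
    two generators. *)
Definition plane_rotation (i k : 'I_d) (c s : R) : 'M[C]_d :=
  1%:M + (c%:C - 1) *: (delta_mx i i + delta_mx k k) +
  s%:C *: (delta_mx i k - delta_mx k i).

Lemma delta_mul_colE (p q m : 'I_d) (psi : 'cV[C]_d) :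
  (delta_mx p q *m psi) m 0 = (m == p)%:R * psi q 0.
Proof.
rewrite mxE (bigD1 q)//= mxE eqxx andbT big1 ?addr0// => t tq.
by rewrite mxE (negbTE tq) andbF mul0r.
Qed.

Lemma plane_rotationE i k c s m (psi : 'cV[C]_d) :
  (plane_rotation i k c s *m psi) m 0 =
  psi m 0 + (c%:C - 1) * ((m == i)%:R * psi i 0 + (m == k)%:R * psi k 0) +
  s%:C * ((m == i)%:R * psi k 0 - (m == k)%:R * psi i 0).
Proof.
have addE (u v : 'cV[C]_d) : (u + v) m 0 = u m 0 + v m 0 by rewrite mxE.
have oppE (u : 'cV[C]_d) : (- u) m 0 = - u m 0 by rewrite mxE.
have scaleE a (u : 'cV[C]_d) : (a *: u) m 0 = a * u m 0 by rewrite mxE.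
rewrite /plane_rotation !mulmxDl mul1mx -!scalemxAl !mulmxDl mulNmx.
by rewrite !(addE, oppE, scaleE) !delta_mul_colE.
Qed.

(** With [D] the projection onto the plane and [K] the generator of its rotations, D is
    self-adjoint, K is skew, DD = D, DK = KD = K and KK = -D. In the product with the adjoint, [D]
    gets the coefficient 2a + a^2 + s^2 with a = c - 1, which is zero. *)
Lemma plane_rotation_unitary i k c s :
  i != k -> c ^+ 2 + s ^+ 2 = 1 -> plane_rotation i k c s \is unitarymx.
Proof.
move=> ik cs1; have ki : k != i by rewrite eq_sym.
pose D : 'M[C]_d := delta_mx i i + delta_mx k k.
pose K : 'M[C]_d := delta_mx i k - delta_mx k i.
have -> : plane_rotation i k c s = 1%:M + (c%:C - 1) *: D + s%:C *: K by [].
have tD : D^t* = D.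
  by rewrite /D; apply/matrixP => p q; rewrite !mxE rmorphD !rmorph_nat
    ![(q == _) && _]andbC.
have tK : K^t* = - K.
  by rewrite /K; apply/matrixP => p q; rewrite !mxE rmorphB !rmorph_nat opprB
    ![(q == _) && _]andbC.
have DD : D *m D = D.
  by rewrite /D mulmxDl !mulmxDr !mul_delta_mx_cond !eqxx (negbTE ik) (negbTE ki)
    !mulr1n !mulr0n addr0 add0r.
have DK : D *m K = K.
  by rewrite /D /K mulmxDl !mulmxBr !mul_delta_mx_cond !eqxx (negbTE ik) (negbTE ki)
    !mulr1n !mulr0n subr0 sub0r.
have KD : K *m D = K.
  by rewrite /D /K mulmxBl !mulmxDr !mul_delta_mx_cond !eqxx (negbTE ik) (negbTE ki)
    !mulr1n !mulr0n addr0 add0r.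
have KK : K *m K = - D.
  by rewrite /D /K mulmxBl !mulmxBr !mul_delta_mx_cond !eqxx (negbTE ik) (negbTE ki)
    !mulr1n !mulr0n subr0 sub0r opprD.
have trD (A B : 'M[C]_d) : (A + B)^t* = A^t* + B^t*.
  by rewrite linearD map_mxD.
have trZ (x : R) (A : 'M[C]_d) : (x%:C *: A)^t* = x%:C *: A^t*.
  by rewrite linearZ map_mxZ; congr (_ *: _); exact: conjc_real.
clearbody D K; set a := c - 1.
have -> : c%:C - 1 = a%:C by rewrite rmorphB rmorph1.
apply/unitarymxP; rewrite !trD !trZ tD tK trmx1 map_mx1.
have s2 : s%:C ^+ 2 = - (a%:C ^+ 2 + 2 * a%:C) :> C.
  rewrite -(rmorph_nat (real_complex R)) -!rmorphXn -rmorphM -rmorphD -rmorphN.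
  by congr (_%:C); rewrite /a; lra.
move: s2; move: (a%:C) (s%:C) => x y s2.
have NN : (x *: D + y *: K) *m (x *: D - y *: K) = (x * x + y * y) *: D.
  rewrite mulmxDl !mulmxBr -!scalemxAl -!scalemxAr DD DK KD KK !scalerA !scalerN.
  by rewrite opprK [y * x]mulrC addrA subrK scalerDl.
have NDN : (x *: D - y *: K) + (x *: D + y *: K) = (x + x) *: D.
  by rewrite addrACA addNr addr0 scalerDl.
rewrite -!addrA scalerN mulmxDl mul1mx mulmxDr mulmx1 NN -addrA.
rewrite [_ - _ + _]addrA NDN -scalerDl -expr2 -[y * y]expr2 s2.
have -> : x + x + (x ^+ 2 - (x ^+ 2 + 2 * x)) = 0 by ring.
by rewrite scale0r addr0.
Qed.

(* The 3-4-5 rotation avoids square roots. *)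
Lemma moment_rotation i k : i != k ->
  moment i i i i = 2 * moment i i k k /\ moment k k k k = moment i i i i.
Proof.
move=> ik; have ki : k != i by rewrite eq_sym.
have uU : plane_rotation i k (3 / 5) (4 / 5) \is unitarymx.
  by apply: plane_rotation_unitary => //; field.
have hi : moment i i i i = (3 / 5)%:C ^+ 4 * moment i i i i +
    (4 / 5)%:C ^+ 4 * moment k k k k +
    4 * ((3 / 5)%:C ^+ 2 * (4 / 5)%:C ^+ 2) * moment i i k k.
  apply: (@moment_combine _ i i k (3 / 5) (4 / 5) ik uU) => psi.
  by rewrite plane_rotationE eqxx (negbTE ik) mulr1n mulr0n; ring.
have hk : moment k k k k = (- (4 / 5))%:C ^+ 4 * moment i i i i +
    (3 / 5)%:C ^+ 4 * moment k k k k +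
    4 * ((- (4 / 5))%:C ^+ 2 * (3 / 5)%:C ^+ 2) * moment i i k k.
  apply: (@moment_combine _ k i k (- (4 / 5)) (3 / 5) ik uU) => psi.
  by rewrite plane_rotationE eqxx (negbTE ki) rmorphN mulr1n mulr0n; ring.
have e3 : (3 / 5)%:C = 3 / 5 :> C by rewrite fmorph_div !rmorph_nat.
have e4 : (4 / 5)%:C = 4 / 5 :> C by rewrite fmorph_div !rmorph_nat.
move: hi hk; rewrite rmorphN e3 e4.
move: (moment i i i i) (moment k k k k) (moment i i k k) => a b c hi hk.
(* [hi] and [hk] have the same term in [c]; their difference leaves (3^4 - 4^4) / 5^4 = -7/25 as the
   factor of b - a. *)
have ba : b = a.
  apply/eqP; rewrite -subr_eq0; apply/eqP.
  have : 32 / 25 * (b - a) = 0.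
    have : b - a = - (7 / 25) * (b - a) by rewrite {1}hi {1}hk; field.
    by move/eqP; rewrite -subr_eq0 => /eqP <-; field.
  by move/eqP; rewrite mulf_eq0 => /orP[|/eqP//]; rewrite mulf_eq0 invr_eq0 !pnatr_eq0.
split => //; rewrite ba in hi; apply/eqP; rewrite -subr_eq0; apply/eqP.
(* Here 1 - (3^4 + 4^4) / 5^4 = 288/625, while the mixed term of [hi] has coefficient 576/625. *)
have : 288 / 625 * (a - 2 * c) = 0.
  by move/eqP: hi; rewrite -subr_eq0 => /eqP <-; field.
by move/eqP; rewrite mulf_eq0 => /orP[|/eqP//]; rewrite mulf_eq0 invr_eq0 !pnatr_eq0.
Qed.

(** This is the integral of the fourth power of the norm, which is 1 on the sphere. *)
Lemma sum_moment_diag : \sum_i \sum_k moment i i k k = 1.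
Proof.
rewrite pair_big/= -(cint_cst 1) -[RHS](@eq_cint (fun psi : V =>
    \sum_(p : 'I_d * 'I_d) 1 * quartic (p.1, p.1, p.2, p.2) psi)).
  rewrite (@cint_quartics _ (index_enum _) (fun=> 1)
    (fun p : 'I_d * 'I_d => (p.1, p.1, p.2, p.2))) //.
  by apply: eq_bigr => p _; rewrite mul1r.
move=> psi; rewrite inE /unit_sphere/= braketE => S1.
under eq_bigr do rewrite mul1r.
rewrite -(pair_big xpredT xpredT
  (fun i k => (psi i 0)^*%C * psi i 0 * psi k 0 * (psi k 0)^*%C))/=.
under eq_bigr => i _.
  under eq_bigr => k _ do rewrite -mulrA [psi k 0 * _]mulrC.
  rewrite -mulr_sumr S1 mulr1; over.
by [].
Qed.

(** The rotations make every moment of a single coordinate equal to 2b and every mixed one equal to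
    b. The d moments of the first kind and d (d - 1) of the second sum to 1, whence b d (d + 1) =
    1. *)
Lemma momentE i j k l : moment i j k l =
  (((i == j) && (k == l))%:R + ((i == k) && (j == l))%:R) / (d%:R * (d%:R + 1)).
Proof.
pose b := moment i i i i / 2.
have diag p : moment p p p p = 2 * b.
  rewrite /b [2 * _]mulrC divfK ?pnatr_eq0//.
  by have [->//|ip] := eqVneq i p; case: (moment_rotation ip).
have offdiag p q : moment p p q q = (1 + (p == q)%:R) * b.
  have [<-|pq] := eqVneq p q; first by rewrite diag.
  have [pE _] := moment_rotation pq; rewrite diag in pE.
  by rewrite addr0 mul1r; apply: (mulfI _ (esym pE)); rewrite pnatr_eq0.
(* The index [i] itself witnesses d > 0. *)
have dn0 : d%:R * (d%:R + 1) != 0 :> C.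
  by rewrite natr1 -natrM pnatr_eq0 muln_eq0 negb_or -!lt0n (leq_ltn_trans _ (ltn_ord i)).
have bE : b = (d%:R * (d%:R + 1))^-1.
  have := sum_moment_diag.
  under eq_bigr => p _.
    under eq_bigr => q _ do rewrite offdiag mulrDl mul1r.
    rewrite big_split/= sumr_const card_ord (bigD1 p)//= eqxx mul1r big1 ?addr0.
      over.
    by move=> q qp; rewrite eq_sym (negbTE qp) mul0r.
  rewrite sumr_const card_ord => sb; apply: (mulfI dn0); rewrite mulfV//; apply: etrans sb.
  by rewrite -[RHS]mulr_natl -[b *+ d]mulr_natl; ring.
rewrite -bE.
have [<-|ij] /= := eqVneq i j.
  have [<-|kl] := eqVneq k l; first by rewrite andbb offdiag.
  rewrite moment_eq0 ?eqxx ?(negbTE kl)//; last first.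
    by apply/negP => /andP[/eqP ik /eqP il]; rewrite -ik il eqxx in kl.
  case: eqP => [ik|_] /=; last by rewrite addr0 mul0r.
  by rewrite ik (negbTE kl) addr0 mul0r.
have [<-|ik] /= := eqVneq i k.
  have [<-|jl] := eqVneq j l.
    by rewrite moment_swap offdiag (negbTE ij) addr0 add0r.
  by rewrite moment_eq0 ?(negbTE ij) ?(negbTE jl) ?andbF// addr0 mul0r.
by rewrite moment_eq0 ?(negbTE ij) ?(negbTE ik)// addr0 mul0r.
Qed.

(** * The average fidelity in terms of matrix entries *)

(** Expanding in matrix units and inserting [momentE], the pairing i = j, k = l collects the trace
    of E(1), and the pairing i = k, j = l collects the entries (k, l) of E(|k><l|). *)
Lemma average_fidelityE (N : superop R d) (Omega : finType)
    (I K : Omega -> superop R d) :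
  average_fidelity mu N I K =
  ReC ((\tr (average_operation N I K 1%:M) +
    \sum_k \sum_l average_operation N I K (delta_mx k l) k l) /
    (d%:R * (d%:R + 1))).
Proof.
set E := average_operation N I K.
have EE A : E A = \sum_k \sum_l A k l *: E (delta_mx k l).
  rewrite /E /average_operation {1}[A]matrix_sum_delta.
  under eq_bigr => w _ do rewrite !linear_sum/=.
  rewrite exchange_big/=; apply: eq_bigr => k _.
  under eq_bigr => w _ do rewrite !linear_sum/=.
  rewrite exchange_big/=; apply: eq_bigr => l _.
  by rewrite scaler_sumr; apply: eq_bigr => w _; rewrite !linearZ.
pose r := index_enum ('I_d * 'I_d * 'I_d * 'I_d)%type.
pose c (t : 'I_d * 'I_d * 'I_d * 'I_d) :=
  let: (i, j, k, l) := t in E (delta_mx k l) i j.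
have sum4 (F : 'I_d -> 'I_d -> 'I_d -> 'I_d -> C) :
    \sum_(t : 'I_d * 'I_d * 'I_d * 'I_d) (let: (i, j, k, l) := t in F i j k l) =
    \sum_i \sum_j \sum_k \sum_l F i j k l.
  rewrite pair_big pair_big pair_big; apply: eq_bigr => -[[[i j] k] l] _ //.
transitivity (ReC (cint (fun psi : V => braket psi (E (ketbra psi) *m psi)))) => //.
congr ReC; rewrite (@cint_quartics _ r c id) => [|psi]; last first.
  rewrite braketE.
  transitivity (\sum_t let: (i, j, k, l) := t in
      E (delta_mx k l) i j * quartic (i, j, k, l) psi); last first.
    by apply: eq_bigr => -[[[i j] k] l] _.
  rewrite sum4; apply: eq_bigr => i _; rewrite mxE mulr_sumr.
  apply: eq_bigr => j _; rewrite EE summxE mulr_suml mulr_sumr.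
  apply: eq_bigr => k _; rewrite summxE mulr_suml mulr_sumr.
  apply: eq_bigr => l _; rewrite mxE /ketbra mxE big_ord1 !mxE conjcE /quartic.
  ring.
transitivity (\sum_t let: (i, j, k, l) := t in E (delta_mx k l) i j * moment i j k l).
  by apply: eq_bigr => -[[[i j] k] l] _.
rewrite sum4 mulrDl; under eq_bigr => i _.
  under eq_bigr => j _.
    under eq_bigr => k _.
      under eq_bigr => l _ do rewrite momentE mulrA mulrDr mulrDl.
      rewrite big_split /= -!mulr_suml. over.
    rewrite big_split /= -!mulr_suml. over.
  rewrite big_split /= -!mulr_suml. over.
rewrite big_split /= -!mulr_suml; congr (_ / _ + _ / _).
- rewrite /mxtrace; apply: eq_bigr => i _; rewrite (bigD1 i)//= [X in _ + X]big1 ?addr0.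
    rewrite EE summxE; apply: eq_bigr => k _; rewrite summxE; apply: eq_bigr => l _.
    by rewrite mxE !mxE eqxx/= mulrC.
  move=> j ji; rewrite big1// => k _; rewrite big1// => l _.
  by rewrite eq_sym (negbTE ji) mulr0.
- apply: eq_bigr => i _; apply: eq_bigr => j _; rewrite (bigD1 i)//= [X in _ + X]big1 ?addr0.
    rewrite (bigD1 j)//= !eqxx mulr1 big1 ?addr0// => l lj.
    by rewrite [j == l]eq_sym (negbTE lj) andbF mulr0.
  move=> k ki; rewrite big1// => l _.
  by rewrite [i == k]eq_sym (negbTE ki) mulr0.
Qed.
End UniformMoments.

(** * Kraus decompositions *)

Lemma addmxE (V : nmodType) m n (A B : 'M[V]_(m, n)) i j :
  (A + B) i j = A i j + B i j.
Proof. by rewrite mxE. Qed.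

Lemma scalemxE (S : pzRingType) m n a (A : 'M[S]_(m, n)) i j :
  (a *: A) i j = a * A i j.
Proof. by rewrite mxE. Qed.

Lemma trmxC_mul (C : numClosedFieldType) m n p (A : 'M[C]_(m, n)) (B : 'M[C]_(n, p)) :
  (A *m B)^t* = B^t* *m A^t*.
Proof. by rewrite trmx_mul map_mxM. Qed.

Lemma mul_row_delta_col (C : numClosedFieldType) m n (A : 'M[C]_(m, n)) i j :
  (delta_mx 0 i *m A *m delta_mx j 0 : 'M[C]_(1, 1)) 0 0 = A i j.
Proof. by rewrite -rowE -colE !mxE. Qed.

Lemma trmxC_delta (C : numClosedFieldType) m n (i : 'I_m) (j : 'I_n) :
  (delta_mx i j : 'M[C]_(m, n))^t* = delta_mx j i.
Proof. by rewrite trmx_delta map_delta_mx. Qed.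

Lemma diag_mx_sum_delta (C : comNzRingType) n (D : 'rV[C]_n) :
  diag_mx D = \sum_m (D 0 m *: (delta_mx m 0 *m (delta_mx 0 m : 'rV_n))).
Proof.
apply/matrixP => i j; rewrite summxE (bigD1 i)//= big1 ?addr0 => [|k ki].
  by rewrite mul_delta_mx !mxE eqxx/= eq_sym; case: eqP; rewrite ?mulr1 ?mulr0.
by rewrite mul_delta_mx !mxE [i == k]eq_sym (negbTE ki) mulr0.
Qed.

(* Polarization on the vectors e_p + z e_q for z = 1 and z = i. *)
Lemma ge0_form_hermsym (C : numClosedFieldType) n (A : 'M[C]_n) :
  (forall v : 'cV[C]_n, 0 <= (v^t* *m A *m v) 0 0) -> A \is hermsymmx.
Proof.
move=> pA; apply/is_hermitianmxP; rewrite expr0 scale1r; apply/matrixP => p q.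
rewrite !mxE.
pose v z : 'cV[C]_n := delta_mx p 0 + z *: delta_mx q 0.
have form z : ((v z)^t* *m A *m v z) 0 0 =
    A p p + z^* * z * A q q + (z * A p q + z^* * A q p).
  have -> : (v z)^t* = delta_mx 0 p + z^* *: delta_mx 0 q.
    by rewrite linearD linearZ /= map_mxD map_mxZ !trmx_delta !map_delta_mx.
  rewrite /v !mulmxDl !mulmxDr -!scalemxAl -!scalemxAr.
  rewrite !(addmxE, scalemxE) !mul_row_delta_col; ring.
have real z : z * A p q + z^* * A q p \is Num.real.
  have dr r : A r r \is Num.real.
    have := pA (delta_mx r 0).
    by rewrite trmxC_delta mul_row_delta_col => /ger0_real.
  have -> : z * A p q + z^* * A q p =
      ((v z)^t* *m A *m v z) 0 0 - (A p p + z^* * z * A q q).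
    by rewrite form; ring.
  apply: rpredB; first exact/ger0_real/pA.
  apply: rpredD => //; apply: rpredM => //.
  by rewrite mulrC ger0_real// mul_conjC_ge0.
have /CrealP := real 1; rewrite rmorph1 !mul1r rmorphD => h1.
have /CrealP := real 'i; rewrite conjCi rmorphD !rmorphM rmorphN/= conjCi opprK => hi.
have {}hi : - (A p q)^* + (A q p)^* = A p q - A q p.
  by apply: (mulfI (neq0Ci C)); rewrite !mulrDr !mulrN -!mulNr.
apply: (@mulfI _ 2); first by rewrite pnatr_eq0.
have -> : 2 * A p q = (A p q + A q p) + (A p q - A q p) by ring.
by rewrite -h1 -hi; ring.
Qed.

(** Spectral theorem: the vectors are eigenvectors scaled by square roots of eigenvalues. *)
Lemma ge0_form_sum_gram (C : numClosedFieldType) n (A : 'M[C]_n) :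
  (forall v : 'cV[C]_n, 0 <= (v^t* *m A *m v) 0 0) ->
  exists u : 'I_n -> 'cV[C]_n, A = \sum_m u m *m (u m)^t*.
Proof.
move=> pA; have /hermitian_normalmx /orthomx_spectralP AE := ge0_form_hermsym pA.
set P := spectralmx A in AE; set D := spectral_diag A in AE.
have uP : P \is unitarymx by exact: spectral_unitarymx.
rewrite invmx_unitary// in AE.
(* An eigenvalue is the value of the form at its unit eigenvector. *)
have D0 m : 0 <= D 0 m.
  have := pA (P^t* *m delta_mx m 0).
  rewrite trmxC_mul trmxCK trmxC_delta AE !mulmxA.
  rewrite -[_ *m P *m P^t*]mulmxA (unitarymxP uP) mulmx1.
  rewrite -[_ *m P *m P^t*]mulmxA (unitarymxP uP) mulmx1.
  by rewrite mul_row_delta_col mxE eqxx mulr1n.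
exists (fun m => sqrtC (D 0 m) *: (P^t* *m delta_mx m 0)).
rewrite {1}AE diag_mx_sum_delta mulmx_sumr mulmx_suml; apply: eq_bigr => m _.
have -> : (sqrtC (D 0 m) *: (P^t* *m delta_mx m 0) : 'cV_n)^t* =
    sqrtC (D 0 m) *: (delta_mx 0 m *m P).
  rewrite linearZ /= map_mxZ trmxC_mul trmxCK trmxC_delta; congr (_ *: _).
  by apply/CrealP/ger0_real; rewrite sqrtC_ge0.
by rewrite -scalemxAr -!scalemxAl -scalemxAr scalerA -expr2 sqrtCK !mulmxA.
Qed.

Section Kraus.
Variables (R : realType).
Local Notation C := R[i].

Lemma psd_gram n (u : 'cV[C]_n) : psd (u *m u^t*).
Proof.
move=> v; rewrite mulmxA -mulmxA -[X in _ *m X]trmxCK trmxC_mul trmxCK.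
by rewrite mxE big_ord1 !mxE mul_conjC_ge0.
Qed.

Lemma psd_conj n m (A : 'M[C]_n) (D : 'M[C]_(m, n)) :
  psd A -> psd (D *m A *m D^t*).
Proof.
move=> pA v; have := pA (D^t* *m v).
by rewrite trmxC_mul trmxCK !mulmxA.
Qed.

Lemma psd_sum n (J : finType) (A : J -> 'M[C]_n) :
  (forall j, psd (A j)) -> psd (\sum_j A j).
Proof.
move=> pA v; rewrite mulmx_sumr mulmx_suml summxE sumr_ge0// => j _.
exact: pA.
Qed.

Variable d : nat.
Local Notation op := 'M[C]_d.

Definition kraus (Phi : superop R d) (J : finType) (K : J -> op) :=
  forall rho, Phi rho = \sum_j K j *m rho *m (K j)^t*.

(** The ampliation has as Kraus operators the block diagonal matrices with [k] copies of each [K j],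
    and each of its terms is a congruence of [A]. *)
Lemma kraus_completely_positive (Phi : superop R d) (J : finType) (K : J -> op) :
  kraus Phi K -> completely_positive Phi.
Proof.
move=> PhiE k A pA.
have -> : ampliation Phi A =
    \sum_j \mxdiag_(i < k) (K j) *m A *m (\mxdiag_(i < k) (K j))^t*.
  rewrite /ampliation.
  under eq_mxblock => i j do rewrite PhiE.
  rewrite mxblock_sum; apply: eq_bigr => j _.
  have -> : (\mxdiag_(i < k) (K j))^t* = \mxdiag_(i < k) (K j)^t*.
    rewrite tr_mxdiag /mxdiag; apply/matrixP => a b; rewrite mxE [LHS]/=.
    rewrite mxE [in RHS]mxE; case: eqP => _; last by rewrite !mxE rmorph0.
    by rewrite !conform_mx_id !mxE.
  by rewrite -[in RHS](submxblockK (p_ := fun=> d) (q_ := fun=> d) A)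
    mul_mxdiag_mxblock mul_mxblock_mxdiag.
by apply: psd_sum => j; exact: psd_conj.
Qed.

Lemma superopE (Phi : superop R d) rho :
  Phi rho = \sum_k \sum_l rho k l *: Phi (delta_mx k l).
Proof.
rewrite {1}[rho]matrix_sum_delta linear_sum; apply: eq_bigr => k _.
by rewrite linear_sum; apply: eq_bigr => l _; rewrite linearZ.
Qed.

(* Choi: Gram-decompose the ampliation of the unnormalized maximally entangled
   projector; its (i, j) block is Phi applied to the matrix unit E_ij. *)
Lemma completely_positive_kraus (Phi : superop R d) : completely_positive Phi ->
  exists (J : finType) (K : J -> op), kraus Phi K.
Proof.
(* The vector sum_i |i>|i>, as a column of blocks. *)
pose w : 'cV[C]_(\sum_(i < d) d) := \mxcol_(i < d) (delta_mx i 0 : 'cV[C]_d).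
move=> /(_ d (w *m w^t*) (@psd_gram _ w)) /ge0_form_sum_gram[u uE].
(* Reshaping a Gram vector: its block [i] becomes column [i] of the Kraus operator. *)
pose K m : op := \matrix_(a, i) submxcol (p_ := fun=> d) (u m) i a 0.
exists 'I_(\sum_(i < d) d), K.
have deltaE k l : Phi (delta_mx k l) =
    \sum_m K m *m delta_mx k l *m (K m)^t*.
  have := congr1 (fun B => submxblock (p_ := fun=> d) (q_ := fun=> d) B k l) uE.
  rewrite /ampliation mxblockK submxblock_sum.
  have -> : submxblock (p_ := fun=> d) (q_ := fun=> d) (w *m w^t*) k l = delta_mx k l.
    have -> : w^t* = \mxrow_(i < d) (delta_mx 0 i : 'rV[C]_d).
      by apply/matrixP => a b; rewrite !mxE rmorph_nat andbC.
    by rewrite /w mul_mxcol_mxrow mxblockK mul_delta_mx.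
  move=> ->; apply: eq_bigr => m _.
  rewrite -(mul_delta_mx (0 : 'I_1)) mulmxA -colE -mulmxA -rowE.
  by apply/matrixP => a b; rewrite !mxE !big_ord1 !mxE.
move=> rho; rewrite superopE; under eq_bigr => k _.
  under eq_bigr => l _ do rewrite deltaE scaler_sumr.
  rewrite exchange_big/=; over.
rewrite exchange_big/=; apply: eq_bigr => m _.
rewrite [in RHS](matrix_sum_delta rho) mulmx_sumr mulmx_suml; apply: eq_bigr => k _.
rewrite mulmx_sumr mulmx_suml; apply: eq_bigr => l _.
by rewrite -scalemxAr -scalemxAl.
Qed.
End Kraus.

(** * A trace inequality *)

Section TraceInequality.
Variable C : numClosedFieldType.

Lemma sum_quadruple (X Y Z T : finType) (F : X -> Y -> Z -> T -> C) :
  \sum_(t : X * Y * Z * T) (let: (i, j, k, l) := t in F i j k l) =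
  \sum_i \sum_j \sum_k \sum_l F i j k l.
Proof. by rewrite pair_big pair_big pair_big; apply: eq_bigr => -[[[]]]. Qed.

(** For the self-adjoint involution S induced by [s], this is (1 + S)^2 = 2 (1 + S) evaluated at
    [f]. *)
Lemma sum_conj_add_involutive (X : finType) (s : X -> X) (f : X -> C) :
  involutive s ->
  \sum_x (f x + f (s x)) * (f x + f (s x))^* =
  2 * (\sum_x f x * (f x)^* + \sum_x f x * (f (s x))^*).
Proof.
move=> sK.
have E1 : \sum_x f (s x) * (f (s x))^* = \sum_x f x * (f x)^*.
  by rewrite [RHS](reindex_inj (inv_inj sK)).
have E2 : \sum_x f (s x) * (f x)^* = \sum_x f x * (f (s x))^*.
  by rewrite [RHS](reindex_inj (inv_inj sK)); apply: eq_bigr => x _; rewrite sK.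
transitivity (\sum_x ((f x * (f x)^* + f x * (f (s x))^*) +
    (f (s x) * (f x)^* + f (s x) * (f (s x))^*))).
  by apply: eq_bigr => x _; rewrite rmorphD; ring.
by rewrite !big_split/= E1 E2; ring.
Qed.

Lemma sum_conj_sub_involutive (X : finType) (s : X -> X) (f : X -> C) :
  involutive s ->
  \sum_x (f x - f (s x)) * (f x - f (s x))^* =
  2 * (\sum_x f x * (f x)^* - \sum_x f x * (f (s x))^*).
Proof.
move=> sK.
have E1 : \sum_x f (s x) * (f (s x))^* = \sum_x f x * (f x)^*.
  by rewrite [RHS](reindex_inj (inv_inj sK)).
have E2 : \sum_x f (s x) * (f x)^* = \sum_x f x * (f (s x))^*.
  by rewrite [RHS](reindex_inj (inv_inj sK)); apply: eq_bigr => x _; rewrite sK.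
transitivity (\sum_x ((f x * (f x)^* - f x * (f (s x))^*) +
    (f (s x) * (f (s x))^* - f (s x) * (f x)^*))).
  by apply: eq_bigr => x _; rewrite rmorphB; ring.
by rewrite big_split/= !sumrB E1 E2; ring.
Qed.

(** Twice the difference of the sides is the sum of the squared moduli of f x - f (s x). *)
Lemma sum_conj_involutive_le (X : finType) (s : X -> X) (f : X -> C) :
  involutive s -> \sum_x f x * (f (s x))^* <= \sum_x f x * (f x)^*.
Proof.
move=> sK; rewrite -subr_ge0 -(@pmulr_rge0 _ 2)// -sum_conj_sub_involutive//.
by apply: sumr_ge0 => x _; exact: mul_conjC_ge0.
Qed.

(* The difference of the two sides is the value at f of the form
   <f, (1 + S)(1 - T) f>, where S and T are the commuting unitary involutions
   induced by s and t; (1 + S)(1 - T) is 4 times a projection. *)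
Lemma sum_conj_commuting_involutive_le (X : finType) (s t : X -> X) (f : X -> C) :
  involutive s -> involutive t -> (forall x, s (t x) = t (s x)) ->
  \sum_x f x * (f (s (t x)))^* + \sum_x f x * (f (t x))^* <=
  \sum_x f x * (f x)^* + \sum_x f x * (f (s x))^*.
Proof.
move=> sK tK st; pose P x := f x + f (s x).
have PP : \sum_x P x * (P x)^* =
    2 * (\sum_x f x * (f x)^* + \sum_x f x * (f (s x))^*).
  exact: sum_conj_add_involutive.
have E1 : \sum_x f (s x) * (f (t x))^* = \sum_x f x * (f (s (t x)))^*.
  rewrite [RHS](reindex_inj (inv_inj sK)).
  by apply: eq_bigr => x _; rewrite st sK.
have E2 : \sum_x f (s x) * (f (s (t x)))^* = \sum_x f x * (f (t x))^*.
  rewrite [RHS](reindex_inj (inv_inj sK)).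
  by apply: eq_bigr => x _; rewrite st.
have PT : \sum_x P x * (P (t x))^* =
    2 * (\sum_x f x * (f (s (t x)))^* + \sum_x f x * (f (t x))^*).
  transitivity (\sum_x ((f x * (f (t x))^* + f x * (f (s (t x)))^*) +
      (f (s x) * (f (t x))^* + f (s x) * (f (s (t x)))^*))).
    by apply: eq_bigr => x _; rewrite /P rmorphD; ring.
  by rewrite !big_split/= E1 E2; ring.
(* After doubling, this is the inequality for the single involution [t], applied to the
   symmetrization [P] of [f] under [s]. *)
rewrite -(@ler_pM2l _ 2)// -PP -PT; exact: sum_conj_involutive_le.
Qed.

(** The squared Frobenius norm, valued in [C]. *)
Definition sqfro m n (A : 'M[C]_(m, n)) : C := \tr (A *m A^t*).

Lemma sqfroE m n (A : 'M[C]_(m, n)) :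
  sqfro A = \sum_i \sum_j A i j * (A i j)^*.
Proof.
apply: eq_bigr => i _; rewrite mxE; apply: eq_bigr => j _.
by rewrite !mxE.
Qed.

(** * Norms and traces of products as pairings of one four-index tensor *)

Section Quartic.
Let conjM (a b : C) : (a * b)^* = a^* * b^*. Proof. exact: rmorphM. Qed.
Variables (m n : nat) (A : 'M[C]_(m, n)) (K : 'M[C]_(n, m)).
Let X := ('I_m * 'I_n * 'I_m * 'I_n)%type.
(** The tensor product of [A] with the adjoint of [K]. Pairing it with itself, or with its image
    under the row swap [s], the column swap [t], or both, gives the four quantities to be
    compared. *)
Let f (x : X) : C := let: (i, j, k, l) := x in A i j * (K l k)^*.
Let s (x : X) : X := let: (i, j, k, l) := x in (k, j, i, l).
Let t (x : X) : X := let: (i, j, k, l) := x in (i, l, k, j).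

Let sK : involutive s. Proof. by case=> [[[]]]. Qed.
Let tK : involutive t. Proof. by case=> [[[]]]. Qed.
Let stC x : s (t x) = t (s x). Proof. by case: x => [[[]]]. Qed.
Let stK : involutive (s \o t).
Proof. by move=> x; rewrite /= stC sK tK. Qed.

Let sum_f : \sum_x f x * (f x)^* = sqfro A * sqfro K.
Proof.
transitivity (\sum_x let: (i, j, k, l) := x in
    (A i j * (A i j)^*) * (K l k * (K l k)^*)).
  by apply: eq_bigr => -[[[i j] k] l] _; rewrite /f /= conjM conjCK; ring.
rewrite sum_quadruple (sqfroE A) (sqfroE K) exchange_big [X in _ = _ * X]exchange_big.
rewrite exchange_big mulr_suml; apply: eq_bigr => i _.
rewrite mulr_suml; apply: eq_bigr => j _.
by rewrite mulr_sumr; apply: eq_bigr => k _; rewrite mulr_sumr.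
Qed.

Let sum_fs : \sum_x f x * (f (s x))^* = sqfro (K *m A).
Proof.
transitivity (\sum_x let: (i, j, k, l) := x in
    (K l i * A i j) * (K l k * A k j)^*).
  by apply: eq_bigr => -[[[i j] k] l] _; rewrite /f /s /t /= !conjM conjCK; ring.
rewrite sum_quadruple sqfroE.
under eq_bigr => i _ do under eq_bigr => j _ do rewrite exchange_big/=.
under eq_bigr => i _ do rewrite exchange_big/=.
rewrite exchange_big; apply: eq_bigr => l _; rewrite exchange_big.
apply: eq_bigr => j _; rewrite !mxE rmorph_sum mulr_suml.
by apply: eq_bigr => i _; rewrite mulr_sumr.
Qed.

Let sum_ft : \sum_x f x * (f (t x))^* = sqfro (A *m K).
Proof.
transitivity (\sum_x let: (i, j, k, l) := x in
    (A i j * K j k) * (A i l * K l k)^*).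
  by apply: eq_bigr => -[[[i j] k] l] _; rewrite /f /s /t /= !conjM conjCK; ring.
rewrite sum_quadruple sqfroE; apply: eq_bigr => i _; rewrite exchange_big.
apply: eq_bigr => k _; rewrite !mxE rmorph_sum mulr_suml.
by apply: eq_bigr => j _; rewrite mulr_sumr.
Qed.

Let sum_fst : \sum_x f x * (f (s (t x)))^* = \tr (A *m K) * (\tr (A *m K))^*.
Proof.
transitivity (\sum_x let: (i, j, k, l) := x in
    (A i j * K j i) * (A k l * K l k)^*).
  by apply: eq_bigr => -[[[i j] k] l] _; rewrite /f /s /t /= !conjM conjCK; ring.
rewrite sum_quadruple {1}/mxtrace mulr_suml; apply: eq_bigr => i _.
rewrite mxE mulr_suml; apply: eq_bigr => j _.
rewrite /mxtrace rmorph_sum mulr_sumr; apply: eq_bigr => k _.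
by rewrite mxE rmorph_sum mulr_sumr.
Qed.

Lemma sqnorm_mxtrace_mulmx_le :
  \tr (A *m K) * (\tr (A *m K))^* <= sqfro A * sqfro K.
Proof. by rewrite -sum_fst -sum_f; exact: (sum_conj_involutive_le f stK). Qed.

Lemma sqfro_mulmx_le : sqfro (A *m K) <= sqfro A * sqfro K.
Proof. by rewrite -sum_ft -sum_f; exact: sum_conj_involutive_le. Qed.

Lemma sqnorm_mxtrace_add_sqfro_le :
  \tr (A *m K) * (\tr (A *m K))^* + sqfro (A *m K) <=
  sqfro A * sqfro K + sqfro (K *m A).
Proof.
rewrite -sum_fst -sum_ft -sum_f -sum_fs.
exact: sum_conj_commuting_involutive_le.
Qed.
End Quartic.
End TraceInequality.

(** * Fidelity bounds for control protocols *)

Section Protocols.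
Variables (R : realType) (d : nat).
Local Notation C := R[i].
Local Notation op := 'M[C]_d.
Local Notation D := (d%:R : C).

Lemma mxtrace_sum (J : finType) (A : J -> op) :
  \tr (\sum_j A j) = \sum_j \tr (A j).
Proof. exact: raddf_sum. Qed.

Lemma mulmx_delta_trmxC (M : op) k l a b :
  (M *m delta_mx k l *m M^t*) a b = M a k * (M b l)^*.
Proof.
rewrite -(mul_delta_mx (0 : 'I_1)) mulmxA -colE -mulmxA -rowE.
by rewrite mxE big_ord1 !mxE.
Qed.

(** Each bound is a sum over pairs of Kraus operators of an inequality between traces and norms.
    Trace preservation of [K] enters twice: the squared norms of its Kraus operators sum to [D], and
    those of the products [B l *m A j] sum to [p]. Here [x] belongs to the noiseless composition,
    and [y] is [D] times its analogue under complete depolarization. *)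
Lemma control_bounds (I K : superop R d) :
  completely_positive I -> tpcp K ->
  let x := \sum_k \sum_l K (I (delta_mx k l)) k l in
  let y := \sum_k \sum_l \tr (I (delta_mx k l)) * K 1%:M k l in
  let p := \tr (I 1%:M) in
  [/\ x <= D * p, y <= D * p & x + y <= D * p + p].
Proof.
move=> /completely_positive_kraus[J [A IE]] [/completely_positive_kraus[L [B KE]] Ktr].
have pE : \tr (I 1%:M) = \sum_j sqfro (A j).
  by rewrite IE mxtrace_sum; apply: eq_bigr => j _; rewrite mulmx1.
have dE : D = \sum_l sqfro (B l).
  rewrite -(mxtrace1 C d) -Ktr KE mxtrace_sum; apply: eq_bigr => l _.
  by rewrite mulmx1.
have KI rho : K (I rho) = \sum_l \sum_j (B l *m A j) *m rho *m (B l *m A j)^t*.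
  rewrite KE; apply: eq_bigr => l _; rewrite IE mulmx_sumr mulmx_suml.
  by apply: eq_bigr => j _; rewrite trmxC_mul !mulmxA.
have pE' : \tr (I 1%:M) = \sum_l \sum_j sqfro (B l *m A j).
  rewrite -Ktr KI mxtrace_sum; apply: eq_bigr => l _; rewrite mxtrace_sum.
  by apply: eq_bigr => j _; rewrite mulmx1.
have dpE : D * \tr (I 1%:M) = \sum_l \sum_j sqfro (A j) * sqfro (B l).
  rewrite dE pE mulr_suml; apply: eq_bigr => l _; rewrite mulr_sumr.
  by apply: eq_bigr => j _; rewrite mulrC.
(* For a Kraus operator M = BA, the entry (k, l) of the image of |k><l| is M_kk times the conjugate
   of M_ll; the sum is |Tr BA|^2 = |Tr AB|^2. *)
have xE : \sum_k \sum_l K (I (delta_mx k l)) k l =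
    \sum_l \sum_j \tr (A j *m B l) * (\tr (A j *m B l))^*.
  transitivity (\sum_k \sum_l \sum_b \sum_j
      (B b *m A j) k k * ((B b *m A j) l l)^*).
    apply: eq_bigr => k _; apply: eq_bigr => l _.
    rewrite KI summxE; apply: eq_bigr => b _; rewrite summxE.
    by apply: eq_bigr => j _; rewrite mulmx_delta_trmxC.
  under eq_bigr => k _ do rewrite exchange_big/=.
  rewrite exchange_big; apply: eq_bigr => b _.
  under eq_bigr => k _ do rewrite exchange_big/=.
  rewrite exchange_big; apply: eq_bigr => j _.
  rewrite [\tr (A j *m B b)]mxtrace_mulC [in RHS]/mxtrace mulr_suml.
  by apply: eq_bigr => k _; rewrite rmorph_sum mulr_sumr.
have yE : \sum_k \sum_l \tr (I (delta_mx k l)) * K 1%:M k l =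
    \sum_l \sum_j sqfro (A j *m B l).
  transitivity (\sum_k \sum_l \sum_b \sum_j
      (((A j)^t* *m A j) l k * (B b *m (B b)^t*) k l)).
    apply: eq_bigr => k _; apply: eq_bigr => l _.
    rewrite KE summxE mulr_sumr; apply: eq_bigr => b _.
    rewrite IE mxtrace_sum mulr_suml; apply: eq_bigr => j _.
    rewrite mulmx1 [in RHS]mxE; congr (_ * _); apply: eq_bigr => a _.
    by rewrite mulmx_delta_trmxC !mxE mulrC.
  under eq_bigr => k _ do rewrite exchange_big/=.
  rewrite exchange_big; apply: eq_bigr => b _.
  under eq_bigr => k _ do rewrite exchange_big/=.
  rewrite exchange_big; apply: eq_bigr => j _.
  rewrite /sqfro trmxC_mul mulmxA mxtrace_mulC !mulmxA -[_ *m B b *m _]mulmxA.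
  rewrite /mxtrace exchange_big; apply: eq_bigr => l _; rewrite mxE.
  by apply: eq_bigr.
move=> x y p; rewrite /x /y /p dpE xE yE; split.
- by apply: ler_sum => l _; apply: ler_sum => j _; exact: sqnorm_mxtrace_mulmx_le.
- by apply: ler_sum => l _; apply: ler_sum => j _; exact: sqfro_mulmx_le.
- rewrite pE' -!big_split/=; apply: ler_sum => l _; rewrite -!big_split/=.
  by apply: ler_sum => j _; exact: sqnorm_mxtrace_add_sqfro_le.
Qed.

Hypothesis hd : (0 < d)%N.

Let D0 : D != 0. Proof. by rewrite pnatr_eq0 -lt0n. Qed.
Let Dge0 : 0 <= D. Proof. exact: ler0n. Qed.

Lemma depolarizing_trace (eps : R) : trace_preserving (@depolarizing R d eps).
Proof.
move=> A; rewrite /depolarizing mxtraceD !mxtraceZ mxtrace1 rmorphB rmorph1.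
by field.
Qed.

Variables (mu : probability (borel_vec R d) R) (eps : R).
Hypothesis hmu : uniform_on_sphere mu.
Let e : C := eps%:C.

(** * Upper bounds on the fidelity of an arbitrary protocol *)

Section Average.
Variables (Omega : finType) (I K : Omega -> superop R d).
Hypothesis IK : control_protocol I K.

Let x w := \sum_k \sum_l K w (I w (delta_mx k l)) k l.
Let y w := \sum_k \sum_l \tr (I w (delta_mx k l)) * K w 1%:M k l.
Let p w := \tr (I w 1%:M).

Lemma sum_outcome_weight : \sum_w p w = D.
Proof. by case: IK => _ /(_ 1%:M) + _; rewrite mxtrace_sum mxtrace1. Qed.

(** The noise and every correction preserve the trace, so Tr E(1) is the total weight [D]; the other
    term splits linearly into its noiseless and depolarized parts. *)
Lemma average_fidelity_depolarizing :
  average_fidelity mu (@depolarizing R d eps) I K =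
  complex.Re ((D + \sum_w ((1 - e) * x w + e / D * y w)) / (D * (D + 1))).
Proof.
rewrite average_fidelityE//; congr (complex.Re ((_ + _) / _)).
  rewrite -sum_outcome_weight /average_operation mxtrace_sum; apply: eq_bigr => w _.
  by case: IK => _ _ /(_ w)[_ ->]; rewrite depolarizing_trace.
rewrite /average_operation; under eq_bigr => k _.
  under eq_bigr => l _ do rewrite summxE.
  rewrite exchange_big/=; over.
rewrite exchange_big; apply: eq_bigr => w _.
rewrite /x /y !mulr_sumr -big_split; apply: eq_bigr => k _.
rewrite !mulr_sumr -big_split; apply: eq_bigr => l _ /=.
rewrite /depolarizing linearD !linearZ addmxE !scalemxE rmorphB rmorph1 /e.
by congr (_ + _); ring.
Qed.

Hypothesis heps : 0 <= eps <= 1.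

Let e_ge0 : 0 <= e. Proof. by rewrite ler0c; case/andP: heps. Qed.
Let e_le1 : 0 <= 1 - e.
Proof.
by rewrite subr_ge0 /e -(rmorph1 (real_complex R)) lecR; case/andP: heps.
Qed.
Let eD_ge0 : 0 <= e / D. Proof. by rewrite divr_ge0. Qed.

Let bounds w : [/\ x w <= D * p w, y w <= D * p w & x w + y w <= D * p w + p w].
Proof. by case: IK => cI _ tK; exact: control_bounds. Qed.

Let le_Re_fidelity (a b : C) : a <= b ->
  complex.Re ((D + a) / (D * (D + 1))) <= complex.Re ((D + b) / (D * (D + 1))).
Proof.
move=> ab; have : (D + a) / (D * (D + 1)) <= (D + b) / (D * (D + 1)).
  by apply: ler_wpM2r; rewrite ?lerD2l// invr_ge0 mulr_ge0// addr_ge0.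
by rewrite lecE => /andP[].
Qed.

Lemma average_fidelity_le_low : e / D <= 1 - e ->
  average_fidelity mu (@depolarizing R d eps) I K <=
  complex.Re ((D + ((1 - e) * D ^+ 2 + e)) / (D * (D + 1))).
Proof.
move=> le_e; rewrite average_fidelity_depolarizing; apply: le_Re_fidelity.
have -> : (1 - e) * D ^+ 2 + e = \sum_w ((1 - e) * (D * p w) + e / D * p w).
  by rewrite big_split/= -!mulr_sumr sum_outcome_weight divfK//; ring.
apply: ler_sum => w _; case: (bounds w) => hx _ hxy.
(* The regime makes the coefficient of the leftover [x] nonnegative. *)
have -> : (1 - e) * x w + e / D * y w =
  e / D * (x w + y w) + ((1 - e) - e / D) * x w by ring.
have -> : (1 - e) * (D * p w) + e / D * p w =
  e / D * (D * p w + p w) + ((1 - e) - e / D) * (D * p w) by ring.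
by apply: lerD; apply: ler_wpM2l => //; rewrite subr_ge0.
Qed.

Lemma average_fidelity_le_high : 1 - e <= e / D ->
  average_fidelity mu (@depolarizing R d eps) I K <=
  complex.Re ((D + D) / (D * (D + 1))).
Proof.
move=> le_e; rewrite average_fidelity_depolarizing; apply: le_Re_fidelity.
rewrite -[X in _ <= X]sum_outcome_weight.
apply: ler_sum => w _; case: (bounds w) => _ hy hxy.
have -> : (1 - e) * x w + e / D * y w =
  (1 - e) * (x w + y w) + (e / D - (1 - e)) * y w by ring.
(* The multiples of (1 - e) D cancel and (1 - e) + e = 1 remains, so the bound does not depend on
   [eps]. *)
have -> : p w = (1 - e) * (D * p w + p w) + (e / D - (1 - e)) * (D * p w).
  by field.
by apply: lerD; apply: ler_wpM2l => //; rewrite subr_ge0.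
Qed.
End Average.

(** * Protocols attaining the bounds *)

Lemma do_nothing_protocol : control_protocol (fun _ : unit => (idfun : superop R d))
  (fun _ : unit => (idfun : superop R d)).
Proof.
have cid : completely_positive (idfun : superop R d).
  apply: (@kraus_completely_positive _ _ _ unit (fun=> 1%:M)) => rho.
  by rewrite (big_pred1 tt) => [|[]//]; rewrite trmx1 map_mx1 mulmx1 mul1mx.
split => // A; by rewrite (big_pred1 tt) => [|[]//].
Qed.

(** All d^2 terms of [x] equal 1, while in [y] only the d diagonal terms survive. *)
Lemma do_nothing_fidelity :
  average_fidelity mu (@depolarizing R d eps)
    (fun _ : unit => (idfun : superop R d)) (fun _ : unit => (idfun : superop R d)) =
  complex.Re ((D + ((1 - e) * D ^+ 2 + e)) / (D * (D + 1))).
Proof.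
rewrite (average_fidelity_depolarizing do_nothing_protocol).
congr (complex.Re ((_ + _) / _)); rewrite (big_pred1 tt) => [|[]//] /=.
congr (_ + _).
  congr (_ * _); under eq_bigr => k _.
    under eq_bigr => l _ do rewrite mxE !eqxx/=.
    rewrite sumr_const card_ord; over.
  by rewrite sumr_const card_ord -mulrnA -natrX mulnn.
rewrite (eq_bigr (fun=> 1)) => [|k _].
  by rewrite sumr_const card_ord divfK.
rewrite (bigD1 k)//= big1 ?addr0 => [|l lk]; last first.
  by rewrite [in X in _ * X]mxE eq_sym (negbTE lk) mulr0.
rewrite mxE eqxx mulr1 /mxtrace (bigD1 k)//= mxE eqxx big1 ?addr0// => l lk.
by rewrite mxE (negbTE lk).
Qed.

Section Discriminate.
Variable phi : 'I_d -> 'cV[C]_d.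
Hypothesis on : orthonormal_basis phi.

Lemma ketbra_trmxC u : (ketbra u)^t* = ketbra u :> op.
Proof. by rewrite /ketbra trmxC_mul trmxCK. Qed.

Lemma orthonormal_norm w : (phi w)^t* *m phi w = 1%:M.
Proof.
apply/matrixP => i j; rewrite !ord1 [RHS]mxE eqxx.
by have := on w w; rewrite /braket eqxx.
Qed.

Lemma orthonormal_mxtrace_ketbra w : \tr (ketbra (phi w)) = 1.
Proof. by rewrite /ketbra mxtrace_mulC orthonormal_norm mxtrace1. Qed.

Lemma orthonormal_ketbra_idem w : ketbra (phi w) *m ketbra (phi w) = ketbra (phi w).
Proof.
by rewrite /ketbra mulmxA -[_ *m _ *m phi w]mulmxA orthonormal_norm mulmx1.
Qed.

(** The square matrix [F] with the basis as columns has its adjoint as left inverse, hence also as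
    right inverse. *)
Lemma orthonormal_sum_ketbra : \sum_w ketbra (phi w) = 1%:M :> op.
Proof.
pose F : op := \matrix_(a, w) phi w a 0.
have F1 : F^t* *m F = 1%:M.
  apply/matrixP => v w; rewrite [RHS]mxE -on /braket !mxE.
  by apply: eq_bigr => a _; rewrite !mxE.
rewrite -(mulmx1C F1); apply/matrixP => a b; rewrite summxE mxE.
by apply: eq_bigr => w _; rewrite /ketbra mxE big_ord1 !mxE.
Qed.

Lemma discriminate_protocol : control_protocol
  (fun w : 'I_d => (project (phi w) : superop R d))
  (fun w : 'I_d => (reprepare (phi w) : superop R d)).
Proof.
split=> [w|A|w].
- apply: (@kraus_completely_positive _ _ _ unit (fun=> ketbra (phi w))) => rho.
  by rewrite (big_pred1 tt) => [|[]//]; rewrite ketbra_trmxC.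
- rewrite mxtrace_sum -[in RHS](mulmx1 A) -orthonormal_sum_ketbra mulmx_sumr mxtrace_sum.
  apply: eq_bigr => w _ /=; rewrite /project mxtrace_mulC mulmxA.
  by rewrite orthonormal_ketbra_idem mxtrace_mulC.
- split=> [|A /=].
    (* The Kraus operators |phi_w><m|, with m running over the standard basis. *)
    apply: (@kraus_completely_positive _ _ _ 'I_d
      (fun m => phi w *m delta_mx 0 m)) => rho.
    rewrite /= /reprepare /mxtrace scaler_suml; apply: eq_bigr => m _.
    rewrite trmxC_mul trmxC_delta !mulmxA.
    rewrite -[_ *m _ *m rho]mulmxA -[_ *m _ *m delta_mx m 0]mulmxA.
    have -> : delta_mx 0 m *m rho *m delta_mx m 0 = (rho m m)%:M :> 'M[C]_(1, 1).
      apply/matrixP => i j; rewrite !ord1 mul_row_delta_col mxE eqxx mulr1n //.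
    by rewrite mul_mx_scalar /ketbra scalemxAl.
  by rewrite /reprepare mxtraceZ orthonormal_mxtrace_ketbra mulr1.
Qed.

(** Each outcome has x = 1 and y = d, both from Tr P^2 = 1 for the rank-one projection P, and so
    contributes (1 - e) + e = 1. *)
Lemma discriminate_fidelity :
  average_fidelity mu (@depolarizing R d eps)
    (fun w : 'I_d => (project (phi w) : superop R d))
    (fun w : 'I_d => (reprepare (phi w) : superop R d)) =
  complex.Re ((D + D) / (D * (D + 1))).
Proof.
rewrite (average_fidelity_depolarizing discriminate_protocol).
congr (complex.Re ((_ + _) / _)).
have trP w k l : \tr (project (phi w) (delta_mx k l)) = ketbra (phi w) l k.
  rewrite /project mxtrace_mulC mulmxA orthonormal_ketbra_idem.
  rewrite -(mul_delta_mx (0 : 'I_1)) mulmxA mxtrace_mulC mulmxA.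
  by rewrite /mxtrace big_ord1 mul_row_delta_col.
have one w : \sum_k \sum_l ketbra (phi w) l k * ketbra (phi w) k l = 1.
  rewrite exchange_big -(orthonormal_mxtrace_ketbra w).
  rewrite -[in RHS](orthonormal_ketbra_idem w).
  by apply: eq_bigr => k _; rewrite mxE.
rewrite (eq_bigr (fun=> 1)) => [|w _]; first by rewrite sumr_const card_ord.
have -> : \sum_k \sum_l reprepare (phi w) (project (phi w) (delta_mx k l)) k l = 1.
  rewrite -(one w); apply: eq_bigr => k _; apply: eq_bigr => l _.
  by rewrite /reprepare scalemxE trP.
have -> : \sum_k \sum_l \tr (project (phi w) (delta_mx k l)) *
    reprepare (phi w) 1%:M k l = D.
  rewrite -[RHS]mulr1 -[X in _ = _ * X](one w) mulr_sumr; apply: eq_bigr => k _.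
  rewrite mulr_sumr; apply: eq_bigr => l _.
  by rewrite /reprepare scalemxE trP mxtrace1 mulrCA.
by field.
Qed.
End Discriminate.
End Protocols.

(** * Optimality in the regimes of weak and strong noise *)

Theorem theorem1 (R : realType) (d : nat) (hd : (0 < d)%N)
    (mu : probability (borel_vec R d) R) (hmu : uniform_on_sphere mu)
    (eps : R) (heps : 0 <= eps <= 1) :
  (eps <= d%:R / (d%:R + 1) ->
     optimal mu (@depolarizing R d eps)
       (fun _ : unit => (idfun : superop R d))
       (fun _ : unit => (idfun : superop R d)) /\
     optimal_average_fidelity mu (@depolarizing R d eps)
       (1 - eps * ((d%:R - 1) / d%:R))) /\
  (d%:R / (d%:R + 1) <= eps ->
     (forall phi : 'I_d -> 'cV[R[i]]_d, orthonormal_basis phi ->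
        optimal mu (@depolarizing R d eps)
          (fun w : 'I_d => (project (phi w) : superop R d))
          (fun w : 'I_d => (reprepare (phi w) : superop R d))) /\
     optimal_average_fidelity mu (@depolarizing R d eps) (2 / (d%:R + 1))).
Proof.
have d0 : 0 < d%:R :> R by rewrite ltr0n.
have dC : d%:R = (d%:R)%:C :> R[i] by rewrite rmorph_nat.
have eE : eps%:C / d%:R = (eps / d%:R)%:C :> R[i] by rewrite dC fmorph_div.
have aE : 1 - eps%:C = (1 - eps)%:C :> R[i] by rewrite rmorphB rmorph1.
have Q0 : d%:R * (d%:R + 1) != 0 :> R by rewrite mulf_neq0 ?lt0r_neq0// ltr_wpDr.
split=> he.
- have opt : optimal mu (@depolarizing R d eps)
      (fun _ : unit => (idfun : superop R d)) (fun _ : unit => (idfun : superop R d)).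
    split=> [|Omega I K IK]; first exact: do_nothing_protocol.
    rewrite do_nothing_fidelity//; apply: average_fidelity_le_low => //.
    (* Cleared of denominators, eps <= (1 - eps) d is the threshold condition. *)
    rewrite eE aE lecR ler_pdivrMr//.
    by move: he; rewrite ler_pdivlMr ?ltr_wpDr// => he; lra.
  split=> //; exists unit, (fun=> idfun), (fun=> idfun); split=> //.
  rewrite do_nothing_fidelity//.
  (* The numerator equals d (d + 1) - eps (d - 1) (d + 1). *)
  have -> : (d%:R + ((1 - eps%:C) * d%:R ^+ 2 + eps%:C)) / (d%:R * (d%:R + 1)) =
      (1 - eps * ((d%:R - 1) / d%:R))%:C :> R[i].
    rewrite aE dC -rmorphXn -rmorphM -rmorphD -rmorphD -(rmorph1 (real_complex R)).
    rewrite -rmorphD -rmorphM -fmorph_div; congr (_%:C).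
    by field; rewrite lt0r_neq0//= lt0r_neq0 ?ltr_wpDr.
  by [].
- have opt phi : orthonormal_basis phi -> optimal mu (@depolarizing R d eps)
      (fun w : 'I_d => (project (phi w) : superop R d))
      (fun w : 'I_d => (reprepare (phi w) : superop R d)).
    move=> on; split=> [|Omega I K IK]; first exact: discriminate_protocol.
    rewrite discriminate_fidelity//; apply: average_fidelity_le_high => //.
    rewrite eE aE lecR ler_pdivlMr//.
    by move: he; rewrite ler_pdivrMr ?ltr_wpDr// => he; lra.
  (* The standard basis serves as witness that the optimal value is attained. *)
  split=> //; have on : orthonormal_basis (fun i : 'I_d => delta_mx i 0 : 'cV[R[i]]_d).
    move=> i j; rewrite /braket trmxC_delta -rowE mxE.
    by rewrite !mxE eqxx andbT.
  exists 'I_d, (fun w => project (delta_mx w 0)), (fun w => reprepare (delta_mx w 0)).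
  split; first exact: opt on.
  rewrite discriminate_fidelity//.
  have -> : (d%:R + d%:R) / (d%:R * (d%:R + 1)) = (2 / (d%:R + 1))%:C :> R[i].
    have -> : (2 / (d%:R + 1))%:C = 2 / (d%:R + 1) :> R[i].
      by rewrite !natr1 fmorph_div; congr (_ / _); exact: rmorph_nat.
    by field; rewrite natr1 !pnatr_eq0 /= -lt0n hd.
  by [].
Qed.
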